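(* Let $G=(V,E)$ be a finite connected graph and let $\alpha>1$. Let $\mathbf G=\{G_j\}_{j=1}^k$ be a collection of connected subgraphs $G_j=(V_j,E_j)$ of $G$ with $|V_j|\ge2$ for each $j$, $V=\bigcup_{j=1}^kV_j$, and $V_j\cap V_{j'}=\varnothing$ for $j\ne j'$ (so $k\le|V|/2$). Let $\mathbf E=\bigcup_{j=1}^kE_j$, and let $\vec v=(v_e)_{e\in E}\in[0,\infty)^E$ satisfy $v_e=0$ for all $e\in E\setminus\mathbf E$. Then, for the WARM with $W(x)=x^\alpha$: (1) $\vec v\in\mathcal E_G$ if and only if $\frac{|V|}{|V_j|}(v_e)_{e\in E_j}\in\mathcal E_{G_j}$ for each $j=1,\dots,k$; (2) $\vec v\in\mathcal S_G$ if and only if $\frac{|V|}{|V_j|}(v_e)_{e\in E_j}\in\mathcal S_{G_j}$ for each $j=1,\dots,k$.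
   Context: For a finite connected graph $H$ with vertex set $V_H$ and edge set $E_H$, the WARM on $H$ has the edges as colours; at each time a vertex is chosen uniformly at random and one edge incident to it is selected with probability proportional to (its current count)$^\alpha$ and its count is increased by one. With $\Delta_{E_H}=\{\vec v\in\mathbb R^{E_H}:v_e\ge0,\ \sum_{e}v_e=1\}$, define for $\vec v\in\Delta_{E_H}$ $$F(\vec v)_e=-v_e+\frac1{|V_H|}\sum_{x\in e}\frac{v_e^\alpha}{\sum_{e'\in E_H:\,x\in e'}v_{e'}^\alpha},\qquad e\in E_H,$$ where $x\in e$ means that $x$ is an endvertex of $e$ (and $0/0$ is read as $0$; then $F(\vec v)=\vec 0$ forces every denominator to be positive). $\mathcal E_H$ is the set of equilibria, i.e. $\vec v\in\Delta_{E_H}$ with $F(\vec v)=\vec 0$. At an equilibrium, $\mathbf D(\vec v)$ is the matrix of partial derivatives $D_{e,e'}=\partial F(\vec v)_e/\partial v_{e'}$ (one-sided at points with zero coordinates). $\mathcal S_H$ is the set of linearly-stable equilibria, i.e. equilibria for which all eigenvalues of $\mathbf D(\vec v)$ have negative real parts. *)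

(* Defs.v *)
From HB Require Import structures.
From mathcomp Require Import all_boot all_order all_algebra.
From mathcomp Require Import all_classical all_reals all_analysis.
From mathcomp Require Import complex.
Set Implicit Arguments.
Unset Strict Implicit.
Unset Printing Implicit Defensive.
Import Order.TTheory GRing.Theory Num.Theory.
Import numFieldNormedType.Exports.
Local Open Scope classical_set_scope.
Local Open Scope ring_scope.

(* Vertices live in an ambient finite type [T], so that a graph and its
   subgraphs have the same type. *)
Record sgraph (T : finType) := SGraph {
  vset : {set T};
  eset : {set {set T}};
  _ : [forall e in eset, (e \subset vset) && (#|e| == 2)%N] }.

Notation edge H := {e : {set _} | e \in eset H}.

Definition sgraph_connected (T : finType) (H : sgraph T) : Prop :=
  (0 < #|vset H|)%N /\
  {in vset H &, forall x y, connect [rel a b | [set a; b]%SET \in eset H] x y}.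

Definition subgraph (T : finType) (H G : sgraph T) : Prop :=
  {subset vset H <= vset G} /\ {subset eset H <= eset G}.

Definition edge_incl (T : finType) (H G : sgraph T) (HG : subgraph H G)
    (e : edge H) : edge G :=
  exist _ (val e) (HG.2 (val e) (valP e)).

Section Warm.
Context {R : realType} {T : finType} (alpha : R) (H : sgraph T).

Definition simplex : set (edge H -> R) :=
  [set v | (forall e, 0 <= v e) /\ \sum_(e : edge H) v e = 1].

(* In MathComp [x / 0 = 0], which is the convention [0 / 0 = 0] needed here. *)
Definition warm_field (v : edge H -> R) (e : edge H) : R :=
  - v e + #|vset H|%:R^-1 *
    \sum_(x in val e)
      v e `^ alpha / \sum_(e' : edge H | x \in val e') v e' `^ alpha.

Definition equilibria : set (edge H -> R) :=
  [set v | simplex v /\ forall e, warm_field v e = 0].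

(* The increment [h] is restricted to those keeping coordinate [e']
   nonnegative: the derivative is two-sided where [v e' > 0] and one-sided
   from the right where [v e' = 0] ([powR] is not meant for negative bases).
   For [alpha > 1] this limit exists at every equilibrium, since all the
   denominators of [warm_field] are positive there. *)
Definition warm_partial (v : edge H -> R) (e e' : edge H) : R :=
  lim (h^-1 * (warm_field (fun d => v d + h *+ (d == e')) e - warm_field v e)
       @[h --> within [set h : R | 0 <= v e' + h] 0^']).

Definition warm_jacobian (v : edge H -> R) : 'M[R]_#|{: edge H}| :=
  \matrix_(i, j) warm_partial v (enum_val i) (enum_val j).

Definition stable_equilibria : set (edge H -> R) :=
  [set v | equilibria v /\
    forall z : R[i],
      eigenvalue (map_mx (real_complex R) (warm_jacobian v)) z ->
      complex.Re z < 0].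

End Warm.

Definition rescaled_restriction (R : realType) (T : finType)
    (H G : sgraph T) (HG : subgraph H G) (v : edge G -> R) : edge H -> R :=
  fun e => #|vset G|%:R / #|vset H|%:R * v (edge_incl HG e).

(* Main.v *)
(* Write S_x for the sum of v_e^alpha over the edges e at x. As v vanishes off
   the union of the E_j, near G_j only the edges of G_j contribute, and since the
   quotients v_e^alpha / S_x are homogeneous of degree 0, the vector field of
   G_j at the rescaled restriction is |V| / |V_j| times that of G.
   Summing F over all edges shows that a zero of F has total mass 1 exactly when
   every S_x is positive, a condition that is local in x; this gives (1).
   For (2), the Jacobian at an equilibrium is block diagonal: the block of E_j is
   the Jacobian of G_j, and since h^alpha / h -> 0 for alpha > 1 each edge
   outside the union contributes a 1 x 1 block equal to -1. Left eigenvectors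
   therefore restrict to, and extend by zero from, the blocks. *)
Require Import Defs.
From HB Require Import structures.
From mathcomp Require Import all_boot all_order all_algebra.
From mathcomp Require Import all_classical all_reals all_analysis.
From mathcomp Require Import complex ring.
Set Implicit Arguments.
Unset Strict Implicit.
Unset Printing Implicit Defensive.
Import Order.TTheory GRing.Theory Num.Theory.
Import numFieldNormedType.Exports.
Local Open Scope ring_scope.

(** * Vertex weights and sums over the edges of a subgraph *)

Definition vertex_weight (R : realType) (T : finType) (alpha : R)
    (H : sgraph T) (v : edge H -> R) (x : T) : R :=
  \sum_(e : edge H | x \in val e) v e `^ alpha.

Section Graph.
Context {T : finType}.
Implicit Types H G : sgraph T.

Lemma edge_sub H (e : edge H) : val e \subset vset H.
Proof.
by case: H e => V E HE [e He] /=; move/forall_inP: (HE) => /(_ e He) /andP[].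
Qed.

Lemma edge_neq0 H (e : edge H) : exists x, x \in val e.
Proof.
case: H e => V E HE [e He] /=; move/forall_inP: (HE) => /(_ e He) /andP[_ /eqP e2].
by apply/card_gt0P; rewrite e2.
Qed.

Lemma edge_incl_inj H G (HG : subgraph H G) : injective (edge_incl HG).
Proof. by move=> e e' /(congr1 val) /= /val_inj. Qed.

(** [P] is a predicate on vertex sets, so that one condition makes sense for edges of both
    graphs. *)
Lemma sum_edge_incl (R : nmodType) H G (HG : subgraph H G) (P : pred {set T})
    (f : edge G -> R) :
  (forall e, P (val e) -> val e \notin eset H -> f e = 0) ->
  \sum_(e : edge G | P (val e)) f e =
  \sum_(e : edge H | P (val e)) f (edge_incl HG e).
Proof.
move=> f0; rewrite (bigID (fun e : edge G => val e \in eset H)) /=.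
rewrite [X in _ + X]big1 ?addr0; last by move=> e /andP[]; exact: f0.
rewrite (reindex_omap (edge_incl HG) (fun e : edge G => insub (val e))).
  apply: eq_bigl => e /=; rewrite (valP e) andbT.
  by rewrite (valK e) eqxx andbT.
move=> e /andP[_ eH]; rewrite insubT /=.
by congr Some; apply: val_inj.
Qed.

End Graph.

(** * Equilibria through local conditions, and restriction of the field to a subgraph *)

Section Equilibria.
Context {R : realType} {T : finType} (alpha : R).
Implicit Types H G : sgraph T.

Lemma vertex_weight_ge0 H (v : edge H -> R) x : 0 <= vertex_weight alpha v x.
Proof. by apply: sumr_ge0 => e _; exact: powR_ge0. Qed.

Lemma warm_fieldE H (v : edge H -> R) e :
  warm_field alpha v e = - v e + #|vset H|%:R^-1 *
    \sum_(x in val e) v e `^ alpha / vertex_weight alpha v x.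
Proof. by []. Qed.

(** After exchanging the sums, a vertex x contributes S_x / S_x, which is 1 if S_x is nonzero and 0
    by the convention on division otherwise. *)
Lemma sum_warm_field H (v : edge H -> R) :
  \sum_(e : edge H) warm_field alpha v e =
  - (\sum_(e : edge H) v e) +
  #|vset H|%:R^-1 * (\sum_(x in vset H) (vertex_weight alpha v x != 0)%:R).
Proof.
rewrite /warm_field big_split /= sumrN -mulr_sumr; congr (_ + _ * _).
rewrite (exchange_big_dep (mem (vset H))) /=; last first.
  by move=> e x _; exact: (fintype.subsetP (edge_sub e)).
apply: eq_bigr => x _; rewrite -mulr_suml -/(vertex_weight alpha v x).
by have [->|n0] := eqVneq (vertex_weight alpha v x) 0; rewrite ?mul0r ?mulfV.
Qed.

(** By [sum_warm_field], the total mass at a zero of the field is the proportion of vertices with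
    nonzero weight. The global constraint of mass 1 thus becomes a condition at each vertex. *)
Lemma equilibriaP H (v : edge H -> R) : (0 < #|vset H|)%N ->
  equilibria alpha v <->
  [/\ forall e, 0 <= v e,
      forall x, x \in vset H -> 0 < vertex_weight alpha v x &
      forall e, warm_field alpha v e = 0].
Proof.
move=> H0; have Hn0 : #|vset H|%:R != 0 :> R by rewrite pnatr_eq0 -lt0n.
split=> [[[v0 v1] F0]|[v0 vw F0]]; split=> //.
  have := sum_warm_field v; rewrite v1 big1 // => /esym/eqP.
  rewrite addrC subr_eq0 => /eqP /(congr1 (fun a => #|vset H|%:R * a)).
  rewrite mulrA divff // mul1r mulr1 -natr_sum.
  move=> /eqP; rewrite eqr_nat => /eqP sumE x xH.
  (* A single vertex of weight zero would make the count of nonzero weights fall short of the number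
     of vertices. *)
  rewrite lt0r vertex_weight_ge0 andbT; apply/negP => wx0.
  move: sumE; rewrite -sum1_card (bigD1 x) //= (bigD1 (op := addn) x xH) /=.
  rewrite wx0 /= add0n => sumE.
  suff : (\sum_(i in vset H | i != x) (vertex_weight alpha v i != 0)%R <=
          \sum_(i in vset H | i != x) 1)%N by rewrite sumE add1n ltnn.
  by apply: leq_sum => i _; case: (_ == _).
split=> //; have := sum_warm_field v; rewrite big1 // => /esym/eqP.
rewrite addrC subr_eq0 => /eqP <-.
rewrite (eq_bigr (fun=> 1)); last first.
  by move=> x /vw; rewrite lt0r => /andP[->].
by rewrite sumr_const mulVf.
Qed.

(* [u] charges no edge that meets [H] without belonging to it. *)
Definition isolates H G (u : edge G -> R) : Prop :=
  forall (e : edge G) x,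
    x \in val e -> x \in vset H -> val e \notin eset H -> u e = 0.

Lemma vertex_weight_restrict H G (HG : subgraph H G) c (u : edge G -> R) x :
  alpha != 0 -> isolates H u -> (forall e, 0 <= u e) -> 0 <= c ->
  x \in vset H ->
  vertex_weight alpha (fun e => c * u (edge_incl HG e)) x =
  c `^ alpha * vertex_weight alpha u x.
Proof.
move=> a0 uH u0 c0 xH; rewrite /vertex_weight.
rewrite (sum_edge_incl HG (P := fun s => x \in s) (f := fun e => u e `^ alpha)).
  by rewrite mulr_sumr; apply: eq_bigr => e _; rewrite powRM.
by move=> e xe eH; rewrite (uH _ _ xe xH eH) powR0.
Qed.

(** The weights scale by c^alpha, which cancels in each quotient. Stating this for every isolating
    nonnegative [u] makes it apply to perturbed points as well, as derivatives require. *)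
Lemma warm_field_restrict H G (HG : subgraph H G) (u : edge G -> R) e :
  alpha != 0 -> (0 < #|vset G|)%N -> (0 < #|vset H|)%N ->
  isolates H u -> (forall e, 0 <= u e) ->
  warm_field alpha (rescaled_restriction HG u) e =
  #|vset G|%:R / #|vset H|%:R * warm_field alpha u (edge_incl HG e).
Proof.
move=> a0 G0 H0 uH u0; set c := _ / _; have c0 : 0 < c by rewrite divr_gt0 ?ltr0n.
have Gn0 : #|vset G|%:R != 0 :> R by rewrite pnatr_eq0 -lt0n.
rewrite /warm_field mulrDr mulrN; congr (_ + _).
have -> : #|vset H|%:R^-1 = c * #|vset G|%:R^-1 by rewrite /c mulrAC divff ?mul1r.
rewrite -mulrA; congr (_ * (_ * _)); apply: eq_bigr => x xe.
rewrite -!/(vertex_weight _ _ _) vertex_weight_restrict ?(ltW c0) //; last first.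
  exact: (fintype.subsetP (edge_sub e)).
rewrite powRM ?(ltW c0) // invfM mulrACA divff ?mul1r //.
by rewrite gt_eqF ?powR_gt0.
Qed.

End Equilibria.

(** * The filters of admissible increments *)

Section Limits.
Context {R : realType}.
Local Open Scope classical_set_scope.

Lemma within_dnbhs0E (D P : set R) :
  within D 0^' P = nbhs (0 : R) (fun h => h != 0 -> D h -> P h).
Proof. by []. Qed.

Lemma at_right0E (P : set R) : 0^'+ P = nbhs (0 : R) (fun h => 0 < h -> P h).
Proof. by []. Qed.

Lemma within_ge0_dnbhs : within [set h : R | 0 <= 0 + h] 0^' = 0^'+.
Proof.
apply/funext => P; apply/propext; rewrite within_dnbhs0E at_right0E.
split; apply: filterS => h hP.
  by move=> h0; apply: hP; rewrite /= ?add0r ?gt_eqF ?ltW.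
by move=> hn0; rewrite /= add0r => h0; apply: hP; rewrite lt0r hn0.
Qed.

(** Every positive increment is admissible, so the filter is coarser than the one of right
    neighbourhoods. *)
Lemma within_ge_dnbhs_proper (a : R) : 0 <= a ->
  ProperFilter (within [set h : R | 0 <= a + h] 0^').
Proof.
move=> a0; apply: Build_ProperFilter_ex => P; rewrite within_dnbhs0E => aP.
have : 0^'+ P; last by move=> /filter_ex.
rewrite at_right0E; apply: filterS aP => h hP h0.
by apply: hP; rewrite ?gt_eqF //= addr_ge0 // ltW.
Qed.

Lemma nbhs0_scale (c : R) (Q : set R) :
  nbhs (0 : R) Q -> nbhs (0 : R) (fun h => Q (c * h)).
Proof.
move=> Q0; have : c * h @[h --> (0 : R)] --> c * 0.
  by apply: cvgM; [exact: cvg_cst|exact: cvg_id].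
by rewrite mulr0; apply.
Qed.

(** Change of variable in the increment when a coordinate [a] is rescaled to [c * a]. *)
Lemma dnbhs_scale (c a : R) : 0 < c ->
  c^-1 * h @[h --> within [set h | 0 <= c * a + h] 0^'] =
  within [set h | 0 <= a + h] 0^'.
Proof.
move=> c0; have cn0 : c != 0 by rewrite gt_eqF.
apply/funext => P; apply/propext.
rewrite within_dnbhs0E /fmap /nbhs /= within_dnbhs0E /=.
split=> [/(nbhs0_scale c)|/(nbhs0_scale c^-1)]; apply: filterS => h /= hP hn0 ha.
  rewrite mulKf // in hP; apply: hP; first by rewrite mulf_neq0.
  by rewrite -mulrDr mulr_ge0 // ltW.
apply: hP; first by rewrite mulf_neq0 ?invr_eq0.
by rewrite -(pmulr_rge0 _ c0) mulrDr mulVKf.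
Qed.

Lemma fmap_within_eq (U V : Type) (F : set_system U) (D : set U) (f g : U -> V) :
  Filter F -> (forall x, D x -> f x = g x) ->
  fmap f (within D F) = fmap g (within D F).
Proof.
move=> FF fg; apply/funext => P; apply/propext; rewrite /fmap /within /=.
by split; apply: filterS => x /= DP Dx; move: (DP Dx); rewrite fg.
Qed.

(** The quotient is h^(p - 1), with positive exponent. *)
Lemma powR_div_cvg0 (p : R) : 1 < p -> h^-1 * h `^ p @[h --> 0^'+] --> 0.
Proof.
move=> p1; have := powR_cvg0 (x := p - 1); rewrite subr_gt0 => /(_ p1).
apply: cvg_trans; apply: near_eq_cvg; near=> h.
have h0 : 0 < h by near: h; exact: nbhs_right_gt.
by rewrite powRB ?gt_eqF ?implybT // powRr1 ?ltW // mulrC.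
Unshelve. all: by end_near. Qed.

End Limits.

(** * Entries of the Jacobian *)

Section Partial.
Context {R : realType} {T : finType} (alpha : R).
Hypothesis alpha_gt1 : 1 < alpha.
Implicit Types H G : sgraph T.
Local Open Scope classical_set_scope.

Let alpha_neq0 : alpha != 0.
Proof. by rewrite gt_eqF // (lt_trans ltr01). Qed.

(** The factor c of the field cancels against the factor c of the increment. The image filters
    themselves coincide, so existence of the limits is not at issue. *)
Lemma warm_partial_restrict H G (HG : subgraph H G) (v : edge G -> R) e e' :
  (0 < #|vset G|)%N -> (0 < #|vset H|)%N ->
  isolates H v -> (forall d, 0 <= v d) ->
  warm_partial alpha (rescaled_restriction HG v) e e' =
  warm_partial alpha v (edge_incl HG e) (edge_incl HG e').
Proof.
move=> G0 H0 vH v0; rewrite /warm_partial.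
set c : R := #|vset G|%:R / #|vset H|%:R.
have c0 : 0 < c by rewrite divr_gt0 ?ltr0n.
rewrite -(dnbhs_scale (v (edge_incl HG e')) c0); congr lim.
apply: fmap_within_eq => h /= h0.
(* An increment [h] of the rescaled coordinate comes from the increment [c^-1 * h] in [G]. *)
set u := fun d : edge G => v d + (c^-1 * h) *+ (d == edge_incl HG e').
have uE : rescaled_restriction HG u =
    (fun d => rescaled_restriction HG v d + h *+ (d == e')).
  apply/funext => d; rewrite /rescaled_restriction -/c /u mulrDr mulrnAr.
  by rewrite mulVKf ?gt_eqF // (inj_eq (@edge_incl_inj _ _ _ HG)).
have u0 d : 0 <= u d.
  rewrite /u; case: eqP => [->|_]; last by rewrite addr0.
  by rewrite mulr1n -(pmulr_rge0 _ c0) mulrDr mulVKf ?gt_eqF.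
have uH : isolates H u.
  move=> d x xd xH dH; rewrite /u (vH _ _ xd xH dH) add0r.
  by case: eqP dH => // ->; rewrite /= (valP e').
rewrite -uE !warm_field_restrict // -/c -mulrBr invfM invrK mulrA.
by rewrite [h^-1 * c]mulrC.
Qed.

Lemma warm_partial_eq0 H (v : edge H -> R) (e e' : edge H) : 0 <= v e' ->
  (forall h, 0 <= v e' + h ->
    warm_field alpha (fun d => v d + h *+ (d == e')) e = warm_field alpha v e) ->
  warm_partial alpha v e e' = 0.
Proof.
move=> v0 eqF; rewrite /warm_partial.
pose FF := within_ge_dnbhs_proper v0.
apply: lim_near_cst => //.
near=> h; rewrite eqF ?subrr ?mulr0 //.
by near: h; exact: withinT.
Unshelve. all: by end_near. Qed.

(** Moving another coordinate keeps v_e = 0, and then every numerator in the field at [e]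
    vanishes. *)
Lemma warm_partial_row0 H (v : edge H -> R) (e e' : edge H) :
  0 <= v e' -> v e = 0 -> e != e' -> warm_partial alpha v e e' = 0.
Proof.
move=> v0 ve /negbTE ee'; apply: warm_partial_eq0 => // h _.
rewrite /warm_field ee' addr0 ve powR0 //.
by congr (_ + _ * _); rewrite !big1 // => x _; rewrite mul0r.
Qed.

(** The coordinate of [e'] enters none of the denominators at the endvertices of [e]. *)
Lemma warm_partial_disjoint H (v : edge H -> R) (e e' : edge H) :
  0 <= v e' -> (forall x, x \in val e -> x \notin val e') ->
  warm_partial alpha v e e' = 0.
Proof.
move=> v0 ne'; have [x xe] := edge_neq0 e.
have ee' : (e == e') = false by apply/eqP => ee'; have := ne' x xe; rewrite -ee' xe.
apply: warm_partial_eq0 => // h _; rewrite /warm_field ee' addr0.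
congr (_ + _ * _); apply: eq_bigr => y ye; congr (_ / _).
apply: eq_bigr => d yd; case: eqP => [de|]; last by rewrite addr0.
by move: (ne' _ ye); rewrite -de yd.
Qed.

(** From v_e' = 0 an increment h changes the powers and weights by at most h^alpha = o(h), so only
    the linear term of the field survives. *)
Lemma warm_partial_col0 H (v : edge H -> R) (e e' : edge H) :
  (forall x, x \in vset H -> 0 < vertex_weight alpha v x) -> v e' = 0 ->
  warm_partial alpha v e e' = - (e == e')%:R.
Proof.
move=> vw ve'; rewrite /warm_partial ve' within_ge0_dnbhs.
apply: cvg_lim => //.
pose S x := vertex_weight alpha v x.
pose p (h : R) := h `^ alpha.
pose b x : R := (x \in val e')%:R.
have powE h d : (v d + h *+ (d == e')) `^ alpha =
    v d `^ alpha + p h * (d == e')%:R.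
  case: eqP => [->|_]; last by rewrite mulr0 !addr0.
  by rewrite ve' add0r powR0 // add0r mulr1.
have SE h x : vertex_weight alpha (fun d => v d + h *+ (d == e')) x =
    S x + p h * b x.
  rewrite /vertex_weight (eq_bigr _ (fun d _ => powE h d)) big_split /=.
  congr (_ + _); rewrite -mulr_sumr; congr (_ * _).
  rewrite -natr_sum -big_mkcondr /= /b; congr (_%:R).
  case: (boolP (x \in val e')) => xe'.
    rewrite (big_pred1 e') // => d /=; rewrite andbC; case: eqP => //= ->.
    by rewrite xe'.
  by rewrite big1 // => d /andP[xd /eqP de]; move: xe'; rewrite -de xd.
(* This is the difference quotient over a common denominator: with d = 1 if e = e' and 0 otherwise,
   (v_e^alpha + d p) / (S + p b) - v_e^alpha / S = p (d S - v_e^alpha b) / (S (S + p b)). *)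
pose q h := - (e == e')%:R + #|vset H|%:R^-1 * \sum_(x in val e)
  (h^-1 * p h) * (((e == e')%:R * S x - v e `^ alpha * b x)
     / (S x * (S x + p h * b x))).
have S0 x : x \in val e -> 0 < S x.
  by move=> xe; apply: vw; exact: (fintype.subsetP (edge_sub e)).
have q0 : q h @[h --> 0^'+] --> (- (e == e')%:R : R).
  rewrite -[X in _ --> X]addr0; apply: cvgD; first exact: cvg_cst.
  rewrite -[X in _ --> X](mulr0 #|vset H|%:R^-1).
  apply: cvgM; first exact: cvg_cst.
  have sum0 : \sum_(x in val e) (0 : R) = 0 by rewrite big1.
  rewrite -[X in _ --> X]sum0.
  apply: cvg_big => //; first exact: add_continuous.
  move=> x xe; rewrite -[X in _ --> X](mul0r
    (((e == e')%:R * S x - v e `^ alpha * b x) / (S x * (S x + 0 * b x)))).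
  apply: cvgM; first exact: powR_div_cvg0.
  apply: cvgM; first exact: cvg_cst.
  apply: cvgV; first by rewrite mul0r addr0 mulf_neq0 ?gt_eqF ?S0.
  apply: cvgM; first exact: cvg_cst.
  apply: cvgD; first exact: cvg_cst.
  apply: cvgM; last exact: cvg_cst.
  by apply: powR_cvg0; rewrite (lt_trans ltr01).
apply: cvg_trans q0; apply: near_eq_cvg; near=> h.
have h0 : 0 < h by near: h; exact: nbhs_right_gt.
rewrite /q !warm_fieldE powE -[h *+ _]mulr_natr -mulr_sumr.
under [X in _ = h^-1 * (_ + _ * X - _)]eq_bigr do rewrite SE.
set A := \sum_(x in _) _; set B := \sum_(x in _) _; set C := \sum_(x in _) _.
suff -> : B = p h * A + C.
  by move: (_ == _)%:R (#|_|%:R^-1) => d k; field; rewrite gt_eqF.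
rewrite /A /B /C mulr_sumr -big_split /=; apply: eq_bigr => x xe.
have Sx := S0 _ xe; rewrite -/(S x); field; rewrite !gt_eqF //.
by rewrite ltr_wpDr // mulr_ge0 ?powR_ge0 ?ler0n.
Unshelve. all: by end_near. Qed.

End Partial.

(** * Left eigenvectors as functions on the edges *)

Lemma eigenvalue_enumP (F : fieldType) (I : finType) (D : I -> I -> F) (z : F) :
  eigenvalue (\matrix_(i < #|I|, j < #|I|) D (enum_val i) (enum_val j)) z <->
  exists2 u : I -> F, exists i, u i != 0 &
    forall j, \sum_i u i * D i j = z * u j.
Proof.
split=> [/eigenvalueP[w wD w0]|[u [i ui] uD]].
  exists (fun i => w 0 (enum_rank i)).
    have [j wj] : exists j, w 0 j != 0 by apply/rV0Pn.
    by exists (enum_val j); rewrite enum_valK.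
  move=> j; move/rowP: wD => /(_ (enum_rank j)); rewrite !mxE => <-.
  rewrite (reindex (fun i : 'I_#|I| => enum_val i)) /=; last first.
    by apply: onW_bij; exact: enum_val_bij.
  by apply: eq_bigr => i _; rewrite mxE enum_valK enum_rankK.
apply/eigenvalueP; exists (\row_i u (enum_val i)).
  apply/rowP => j; rewrite !mxE -uD
    (reindex (fun i : 'I_#|I| => enum_val i)) /=; last first.
    by apply: onW_bij; exact: enum_val_bij.
  by apply: eq_bigr => k _; rewrite !mxE.
apply/rV0Pn; exists (enum_rank i).
by rewrite mxE enum_rankK.
Qed.

Lemma stable_equilibriaP (R : realType) (T : finType) (alpha : R) (H : sgraph T)
    (v : edge H -> R) :
  stable_equilibria alpha v <->
  equilibria alpha v /\
  forall (z : R[i]) (u : edge H -> R[i]), (exists e, u e != 0) ->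
    (forall e', \sum_e u e * real_complex R (warm_partial alpha v e e') =
      z * u e') ->
    complex.Re z < 0.
Proof.
pose D e e' := real_complex R (warm_partial alpha v e e').
have JE : map_mx (real_complex R) (warm_jacobian alpha v) =
    \matrix_(i, j) D (enum_val i) (enum_val j).
  by apply/matrixP => i j; rewrite !mxE.
split=> -[veq vst]; split=> // z.
  by move=> u u0 uD; apply: vst; rewrite JE; apply/eigenvalue_enumP; exists u.
by rewrite JE => /eigenvalue_enumP[u u0 uD]; exact: vst u0 uD.
Qed.

(** * Assembling the blocks *)

Theorem theorem1p22 (R : realType) (T : finType) (G : sgraph T) (alpha : R)
    (k : nat) (Gs : 'I_k -> sgraph T) (v : edge G -> R)
    (G_connected : sgraph_connected G)
    (alpha_gt1 : 1 < alpha)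
    (Gs_subgraph : forall j, subgraph (Gs j) G)
    (Gs_connected : forall j, sgraph_connected (Gs j))
    (Gs_size : forall j, (2 <= #|vset (Gs j)|)%N)
    (Gs_cover : vset G = (\bigcup_(j : 'I_k) vset (Gs j))%SET)
    (Gs_disjoint : forall j j', j != j' -> [disjoint vset (Gs j) & vset (Gs j')])
    (v_ge0 : forall e, 0 <= v e)
    (v_eq0 : forall e,
       val e \notin (\bigcup_(j : 'I_k) eset (Gs j))%SET -> v e = 0) :
  (equilibria alpha v <->
     forall j, equilibria alpha (rescaled_restriction (Gs_subgraph j) v)) /\
  (stable_equilibria alpha v <->
     forall j, stable_equilibria alpha (rescaled_restriction (Gs_subgraph j) v)).
Proof.
have a0 : alpha != 0 by rewrite gt_eqF // (lt_trans ltr01).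
have G0 : (0 < #|vset G|)%N by case: G_connected.
have H0 j : (0 < #|vset (Gs j)|)%N by case: (Gs_connected j).
have disE j j' x : x \in vset (Gs j) -> x \in vset (Gs j') -> j = j'.
  move=> xj xj'; apply/eqP; apply: contraT => /Gs_disjoint dis.
  by rewrite (disjointFr dis xj) in xj'.
have edgeE j (e : edge G) x : val e \in eset (Gs j) -> x \in val e ->
    x \in vset (Gs j).
  by move=> ej xe; exact: (fintype.subsetP (edge_sub (exist _ (val e) ej))).
(* An edge that meets V_j and lies in some E_j' has j' = j by disjointness; any other edge at V_j
   carries no mass. *)
have iso j : isolates (Gs j) v.
  move=> e x xe xj ej; apply: v_eq0; apply/finset.bigcupP => -[j' _ ej'].
  by move: ej; rewrite (disE _ _ _ xj (edgeE _ _ _ ej' xe)) ej'.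
have inclE j (e : edge G) (ej : val e \in eset (Gs j)) :
    edge_incl (Gs_subgraph j) (exist _ (val e) ej) = e by exact: val_inj.
have c0 j : 0 < #|vset G|%:R / #|vset (Gs j)|%:R :> R.
  by rewrite divr_gt0 ?ltr0n.
have weightE j x : x \in vset (Gs j) ->
    (0 < vertex_weight alpha (rescaled_restriction (Gs_subgraph j) v) x) =
    (0 < vertex_weight alpha v x).
  move=> xj; rewrite /rescaled_restriction vertex_weight_restrict ?ltW //.
  by rewrite pmulr_rgt0 ?powR_gt0.
have eqE : equilibria alpha v <->
    forall j, equilibria alpha (rescaled_restriction (Gs_subgraph j) v).
  split=> [/(equilibriaP _ _ G0)[_ vw F0] j|eqs].
    apply/equilibriaP; first exact: H0.
    split=> [e|x xj|e]; first exact: mulr_ge0 (ltW (c0 j)) _.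
      by rewrite weightE // vw // (Gs_subgraph j).1.
    by rewrite warm_field_restrict // F0 mulr0.
  apply/equilibriaP => //; split=> // [x|e].
    rewrite Gs_cover => /finset.bigcupP[j _ xj].
    by have /(equilibriaP _ _ (H0 j))[_ + _] := eqs j => /(_ x xj); rewrite weightE.
  have [/finset.bigcupP[j _ ej]|/v_eq0 ve] :=
      boolP (val e \in (\bigcup_(j : 'I_k) eset (Gs j))%SET); last first.
    rewrite warm_fieldE ve powR0 // big1 ?mulr0 ?oppr0 ?addr0 // => x _.
    by rewrite mul0r.
  have /(equilibriaP _ _ (H0 j))[_ _ /(_ (exist _ (val e) ej))] := eqs j.
  rewrite warm_field_restrict // inclE => /eqP.
  by rewrite mulf_eq0 gt_eqF //= => /eqP.
split=> //.
(* Block structure: the entry vanishes by its row if [e] is outside the union, by its column if [e']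
   is, and otherwise because edges of distinct subgraphs share no vertex. *)
have decoupled j (e e' : edge G) : equilibria alpha v ->
    (val e \in eset (Gs j)) != (val e' \in eset (Gs j)) ->
    warm_partial alpha v e e' = 0.
  move=> /(equilibriaP _ _ G0)[_ vw _] nee'.
  have ee' : e != e' by apply: contra nee' => /eqP ->.
  have [/finset.bigcupP[j1 _ ej1]|/v_eq0 ve] :=
      boolP (val e \in (\bigcup_(j : 'I_k) eset (Gs j))%SET); last first.
    exact: warm_partial_row0.
  have [/finset.bigcupP[j2 _ ej2]|/v_eq0 ve'] :=
      boolP (val e' \in (\bigcup_(j : 'I_k) eset (Gs j))%SET); last first.
    by rewrite warm_partial_col0 // (negbTE ee') oppr0.
  apply: warm_partial_disjoint => // x xe; apply/negP => xe'.
  have inj i : val e \in eset (Gs i) <-> val e' \in eset (Gs i).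
    split=> ei; [rewrite (_ : i = j2) //|rewrite (_ : i = j1) //];
    apply: (disE _ _ x); eauto.
  by move/eqP: nee'; apply; apply/idP/idP => /inj.
have partialE j e e' :
    warm_partial alpha (rescaled_restriction (Gs_subgraph j) v) e e' =
    warm_partial alpha v (edge_incl (Gs_subgraph j) e)
      (edge_incl (Gs_subgraph j) e').
  exact: warm_partial_restrict.
split=> [/stable_equilibriaP[veq vst] j|st].
  apply/stable_equilibriaP; split; first exact: eqE.1.
  move=> z u [e0 ue0] uD.
  (* Extension by zero of the eigenvector of the block. In columns outside E_j, both sides of the
     eigenvector equation vanish by [decoupled]. *)
  pose U (e : edge G) : R[i] :=
    if insub (val e) is Some e' then u e' else 0.
  have UE e : U (edge_incl (Gs_subgraph j) e) = u e by rewrite /U /= valK.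
  have U0 (e : edge G) : val e \notin eset (Gs j) -> U e = 0.
    by move=> ej; rewrite /U insubF // (negbTE ej).
  apply: (vst z U).
    by exists (edge_incl (Gs_subgraph j) e0); rewrite UE.
  move=> e'.
  rewrite (sum_edge_incl (Gs_subgraph j) (P := xpredT)); last first.
    by move=> e _ /U0 ->; rewrite mul0r.
  have [ej'|ej'] := boolP (val e' \in eset (Gs j)).
    rewrite -(inclE _ _ ej') UE -uD; apply: eq_bigr => e _.
    by rewrite UE partialE.
  rewrite U0 // mulr0 big1 // => e _; rewrite (decoupled j) ?rmorph0 ?mulr0 //.
  by rewrite /= (valP e) (negbTE ej').
have veq : equilibria alpha v.
  by apply/eqE => j; have /stable_equilibriaP[] := st j.
apply/stable_equilibriaP; split=> // z U [e1 Ue1] UD.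
(* A nonzero coordinate [e1] of [U] selects the block: if [e1] is in E_j, the restriction of [U] to
   E_j is a nonzero left eigenvector there. *)
have [/finset.bigcupP[j _ ej]|/v_eq0 ve1] :=
    boolP (val e1 \in (\bigcup_(j : 'I_k) eset (Gs j))%SET).
  have /stable_equilibriaP[_ stj] := st j.
  apply: (stj z (fun e => U (edge_incl (Gs_subgraph j) e))).
    by exists (exist _ (val e1) ej); rewrite inclE.
  move=> e'; rewrite -UD [RHS](sum_edge_incl (Gs_subgraph j) (P := xpredT)).
    by apply: eq_bigr => e _; rewrite partialE.
  move=> e _ ej0; rewrite (decoupled j) ?rmorph0 ?mulr0 //.
  by rewrite /= (valP e') (negbTE ej0).
have /(equilibriaP _ _ G0)[_ vw _] := veq.
(* Outside the union, column [e1] has the sole nonzero entry -1 on the diagonal, which forces z =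
   -1. *)
have := UD e1; rewrite (bigD1 e1) //= big1 ?addr0; last first.
  by move=> e ne; rewrite warm_partial_col0 // (negbTE ne) oppr0 rmorph0 mulr0.
rewrite warm_partial_col0 // eqxx rmorphN1 mulrC => /(mulIf Ue1) <-.
by rewrite /= oppr_lt0 ltr01.
Qed.
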